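(* Let $\mathbf R,\mathbf S\in\mathbb R^{d_x\times d_y}$, $\mathcal X=\Delta^{d_x}$, $\mathcal Y=\Delta^{d_y}$ (probability simplices), and suppose $x^\top\mathbf Sy\ge\zeta>0$ for all $(x,y)\in\mathcal X\times\mathcal Y$. Consider the ratio game $V(x,y):=\frac{x^\top\mathbf Ry}{x^\top\mathbf Sy}$. If both players employ optimistic gradient descent (OGD) with a suitable learning rate schedule, $O(1/\epsilon^2)$ iterations suffice to reach a point $(x^{(i)},y^{(i)})\in\mathcal X\times\mathcal Y$ such that $$V(x^{(i)},y^{(i)})-\min_{x\in\mathcal X}V(x,y^{(i)})\le\epsilon\quad\text{and}\quad\max_{y\in\mathcal Y}V(x^{(i)},y)-V(x^{(i)},y^{(i)})\le\epsilon .$$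
   Context: Player $x$ minimizes and player $y$ maximizes $V$. The $O(\cdot)$ notation suppresses factors that depend polynomially on the natural parameters of the problem. The variant of OGD considered, started from $\hat x^{(0)}=x^{(0)}\in\mathcal X$, $\hat y^{(0)}=y^{(0)}\in\mathcal Y$, is, for $i\ge1$, $x^{(i)}=\mathrm{Proj}_{\mathcal X}\big(\hat x^{(i-1)}-\eta\alpha_x^{(i-1)}\nabla_xV(x^{(i-1)},y^{(i-1)})\big)$, $\hat x^{(i)}=\mathrm{Proj}_{\mathcal X}\big(\hat x^{(i-1)}-\eta\alpha_x^{(i)}\nabla_xV(x^{(i)},y^{(i)})\big)$, $y^{(i)}=\mathrm{Proj}_{\mathcal Y}\big(\hat y^{(i-1)}+\eta\alpha_y^{(i-1)}\nabla_yV(x^{(i-1)},y^{(i-1)})\big)$, $\hat y^{(i)}=\mathrm{Proj}_{\mathcal Y}\big(\hat y^{(i-1)}+\eta\alpha_y^{(i)}\nabla_yV(x^{(i)},y^{(i)})\big)$, with Euclidean projections and $\eta>0$. The learning rate schedule, which is only asserted to exist, is given by the weights $\alpha_x^{(i)}=\frac{(x^{(i)})^\top\mathbf Sy^{(i)}}{(x^\star)^\top\mathbf Sy^{(i)}}$ and $\alpha_y^{(i)}=\frac{(x^{(i)})^\top\mathbf Sy^{(i)}}{(x^{(i)})^\top\mathbf Sy^\star}$, where $(x^\star,y^\star)\in\mathcal X\times\mathcal Y$ is associated with the sequence of iterates through the condition $\sum_{i=1}^m\alpha_x^{(i)}\langle\nabla_xV(x^{(i)},y^{(i)}),x^{(i)}-x^\star\rangle+\sum_{i=1}^m\alpha_y^{(i)}\langle\nabla_yV(x^{(i)},y^{(i)}),y^\star-y^{(i)}\rangle\ge0$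 ($m$ being the number of iterations), and may thus depend on the whole sequence. *)

(* Defs.v *)
From HB Require Import structures.
From mathcomp Require Export all_boot all_order all_algebra.
From mathcomp Require Export all_classical all_reals all_analysis.
Export Order.TTheory GRing.Theory Num.Theory.
Export numFieldNormedType.Exports.

Set Implicit Arguments.
Unset Strict Implicit.
Unset Printing Implicit Defensive.

#[export] Set Implicit Arguments.

Global Open Scope classical_set_scope.
Global Open Scope ring_scope.

Section RatioGame.
Variable K : realType.

Definition dotp (n : nat) (u v : 'cV[K]_n) : K := (u^T *m v) 0 0.

(* The norm [`|u|] of the library on matrices is the sup norm, so the Euclidean
   norm used by the projections is defined separately. *)
Definition l2norm (n : nat) (u : 'cV[K]_n) : K := Num.sqrt (dotp u u).

Definition simplex (n : nat) : set 'cV[K]_n :=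
  [set x | (forall i, 0 <= x i 0) /\ \sum_i x i 0 = 1].

Definition is_proj (n : nat) (C : set 'cV[K]_n) (z p : 'cV[K]_n) : Prop :=
  C p /\ forall q, C q -> l2norm (z - p) <= l2norm (z - q).

Definition gradient (n : nat) (f : 'cV[K]_n -> K) (x : 'cV[K]_n) : 'cV[K]_n :=
  \col_j 'D_(delta_mx j 0) f x.

Definition is_min (A : set K) (v : K) : Prop := A v /\ lbound A v.
Definition is_max (A : set K) (v : K) : Prop := A v /\ ubound A v.

Definition bilin (dx dy : nat) (M : 'M[K]_(dx, dy)) (x : 'cV[K]_dx)
    (y : 'cV[K]_dy) : K := (x^T *m M *m y) 0 0.

(* [V] is total; outside [x^T S y != 0] it takes the junk value given by
   division by zero.  On the product of simplices the denominator is positive,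
   hence nonzero in a neighbourhood, so the derivatives there are genuine. *)
Definition ratioV (dx dy : nat) (R S : 'M[K]_(dx, dy)) (x : 'cV[K]_dx)
    (y : 'cV[K]_dy) : K := bilin R x y / bilin S x y.

Definition gradx (dx dy : nat) (V : 'cV[K]_dx -> 'cV[K]_dy -> K)
    (x : 'cV[K]_dx) (y : 'cV[K]_dy) : 'cV[K]_dx := gradient (fun u => V u y) x.

Definition grady (dx dy : nat) (V : 'cV[K]_dx -> 'cV[K]_dy -> K)
    (x : 'cV[K]_dx) (y : 'cV[K]_dy) : 'cV[K]_dy := gradient (fun v => V x v) y.

(* Optimistic gradient descent (player x) / ascent (player y) on [V] over
   [X * Y], with base step [eta] and time-varying weights [ax], [ay];
   [xh], [yh] are the secondary ("hatted") iterates. *)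
Definition is_OGD (dx dy : nat) (X : set 'cV[K]_dx) (Y : set 'cV[K]_dy)
    (V : 'cV[K]_dx -> 'cV[K]_dy -> K) (eta : K) (ax ay : nat -> K)
    (x0 : 'cV[K]_dx) (y0 : 'cV[K]_dy)
    (x xh : nat -> 'cV[K]_dx) (y yh : nat -> 'cV[K]_dy) : Prop :=
  [/\ x 0%N = x0 /\ xh 0%N = x0,
      y 0%N = y0 /\ yh 0%N = y0 &
      forall i : nat,
      [/\ is_proj X (xh i - (eta * ax i) *: gradx V (x i) (y i)) (x i.+1),
          is_proj X (xh i - (eta * ax i.+1) *: gradx V (x i.+1) (y i.+1))
                  (xh i.+1),
          is_proj Y (yh i + (eta * ay i) *: grady V (x i) (y i)) (y i.+1) &
          is_proj Y (yh i + (eta * ay i.+1) *: grady V (x i.+1) (y i.+1))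
                  (yh i.+1)]].

Definition weightx (dx dy : nat) (S : 'M[K]_(dx, dy)) (xs : 'cV[K]_dx)
    (x : nat -> 'cV[K]_dx) (y : nat -> 'cV[K]_dy) (i : nat) : K :=
  bilin S (x i) (y i) / bilin S xs (y i).

Definition weighty (dx dy : nat) (S : 'M[K]_(dx, dy)) (ys : 'cV[K]_dy)
    (x : nat -> 'cV[K]_dx) (y : nat -> 'cV[K]_dy) (i : nat) : K :=
  bilin S (x i) (y i) / bilin S (x i) ys.

(* Nonnegativity of the sum of the players' weighted regrets against
   [(xs, ys)] over the iterates 1, ..., m. *)
Definition regret_sum_ge0 (dx dy : nat) (V : 'cV[K]_dx -> 'cV[K]_dy -> K)
    (ax ay : nat -> K) (x : nat -> 'cV[K]_dx) (y : nat -> 'cV[K]_dy)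
    (xs : 'cV[K]_dx) (ys : 'cV[K]_dy) (m : nat) : Prop :=
  0 <= \sum_(1 <= i < m.+1) ax i * dotp (gradx V (x i) (y i)) (x i - xs)
     + \sum_(1 <= i < m.+1) ay i * dotp (grady V (x i) (y i)) (ys - y i).

Definition eps_equilibrium (dx dy : nat) (X : set 'cV[K]_dx)
    (Y : set 'cV[K]_dy) (V : 'cV[K]_dx -> 'cV[K]_dy -> K) (eps : K)
    (x : 'cV[K]_dx) (y : 'cV[K]_dy) : Prop :=
  [/\ X x, Y y,
      exists2 v, is_min [set V u y | u in X] v & V x y - v <= eps &
      exists2 w, is_max [set V x u | u in Y] w & w - V x y <= eps].

End RatioGame.

Arguments simplex {K} n.

(* Main.v *)
Require Import Defs.
From mathcomp Require Import ring lra.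

(* Take for (xs, ys) a saddle point of V, which exists by the minimax theorem
   for ratio games; no dependence on the iterates is needed.  The derivative of
   V along x - xs, multiplied by the weight of the player x, is exactly
   V(x, y) - V(xs, y), and symmetrically for y, so that each weighted regret sum
   has only nonnegative terms V(x_i, ys) - V(xs, y_i).

   The weighted gradients are Lipschitz on the product of simplices.  The usual
   regret inequality of optimistic descent therefore bounds the second-order
   path length: the sum over i of |x_i - xh_(i-1)|^2 + |x_i - xh_i|^2, with the
   same terms for y, is at most 16.  Some step i <= m moves by at most
   4 / sqrt m, and the optimality condition of the projection defining xh_i
   then bounds the gap of each player by a multiple of 1 / sqrt m. *)

Set Implicit Arguments.
Unset Strict Implicit.
Unset Printing Implicit Defensive.

(** * Euclidean geometry of the simplex *)

Section Dotp.
Variables (K : realType) (n : nat).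
Implicit Types u v w z p q : 'cV[K]_n.

Lemma dotpE u v : dotp u v = \sum_i u i 0 * v i 0.
Proof. by rewrite /dotp mxE; apply: eq_bigr => i _; rewrite mxE. Qed.

Lemma dotpC u v : dotp u v = dotp v u.
Proof. by rewrite !dotpE; apply: eq_bigr => i _; rewrite mulrC. Qed.

Lemma dotpDl u v w : dotp (u + v) w = dotp u w + dotp v w.
Proof. by rewrite /dotp linearD/= mulmxDl mxE. Qed.

Lemma dotpNl u w : dotp (- u) w = - dotp u w.
Proof. by rewrite /dotp linearN/= mulNmx mxE. Qed.

Lemma dotpZl a u w : dotp (a *: u) w = a * dotp u w.
Proof. by rewrite /dotp linearZ/= -scalemxAl mxE. Qed.

Lemma dotpDr u v w : dotp w (u + v) = dotp w u + dotp w v.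
Proof. by rewrite dotpC dotpDl !(dotpC w). Qed.

Lemma dotpNr u w : dotp w (- u) = - dotp w u.
Proof. by rewrite dotpC dotpNl dotpC. Qed.

Lemma dotpZr a u w : dotp w (a *: u) = a * dotp w u.
Proof. by rewrite dotpC dotpZl dotpC. Qed.

Definition dotp_bilin :=
  (dotpDl, dotpDr, dotpNl, dotpNr, dotpZl, dotpZr).

Lemma dotp_ge0 u : 0 <= dotp u u.
Proof. by rewrite dotpE; apply: sumr_ge0 => i _; rewrite -expr2 sqr_ge0. Qed.

(** Cauchy-Schwarz without square roots, obtained by expanding [|b u - a v|^2 >= 0]. *)
Lemma dotp_le u v (a b : K) : 0 < a -> 0 < b ->
  dotp u u <= a ^+ 2 -> dotp v v <= b ^+ 2 -> dotp u v <= a * b.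
Proof.
move=> a0 b0 ua vb.
have := dotp_ge0 (b *: u - a *: v).
rewrite !dotp_bilin (dotpC v u) => H.
have ab0 : 0 < a * b by exact: mulr_gt0.
rewrite -(ler_pM2l ab0).
have : b ^+ 2 * dotp u u <= b ^+ 2 * a ^+ 2 by rewrite ler_pM2l ?exprn_gt0.
have : a ^+ 2 * dotp v v <= a ^+ 2 * b ^+ 2 by rewrite ler_pM2l ?exprn_gt0.
nra.
Qed.

(** The difference of the two sides is, up to a factor [n], the sum of the squares
    [(n |u_i| - s)^2], that is, the variance of the absolute values. *)
Lemma l1_norm_sqr_le u : (\sum_i `|u i 0|) ^+ 2 <= n%:R * dotp u u.
Proof.
set s := \sum_i _.
have [n0|n0] := eqVneq n 0%N.
  rewrite /s big1; first by rewrite expr0n /= mulr_ge0 ?dotp_ge0.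
  by move=> i _; have := ltn_ord i; rewrite {2}n0.
have nK : 0 < n%:R :> K by rewrite ltr0n lt0n.
have : 0 <= \sum_(i < n) (n%:R * `|u i 0| - s) ^+ 2.
  by apply: sumr_ge0 => i _; exact: sqr_ge0.
have -> : \sum_(i < n) (n%:R * `|u i 0| - s) ^+ 2
   = n%:R * (n%:R * dotp u u - s ^+ 2).
  transitivity (\sum_(i < n) (n%:R ^+ 2 * (u i 0 * u i 0)
      + ((- (2 * n%:R * s)) * `|u i 0| + s ^+ 2))).
    apply: eq_bigr => i _.
    by rewrite -(expr2 (u i 0)) -(real_normK (num_real (u i 0))); ring.
  rewrite !big_split /= -!mulr_sumr -dotpE -/s sumr_const card_ord -mulr_natl.
  ring.
by rewrite pmulr_rge0 // subr_ge0.
Qed.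

End Dotp.

Section Simplex.
Variable K : realType.

(** The first-order optimality condition along a segment, for an objective dominated by a
    quadratic. *)
Lemma quadratic_ge0_slope (a b : K) :
  (forall t, 0 < t <= 1 -> 0 <= t * a + t ^+ 2 * b) -> 0 <= a.
Proof.
move=> H; rewrite leNgt; apply/negP => a0.
have d0 : 0 < `|a| + `|b| by rewrite ltr_pwDl // normr_gt0 ltr0_neq0.
(* This [t] makes [t |b|] smaller than [|a| / 2], so [a + t b] keeps the negative sign of [a]. *)
pose t := `|a| / (2 * (`|a| + `|b|)).
have t0 : 0 < t by rewrite divr_gt0 ?mulr_gt0 // normr_gt0 ltr0_neq0.
have tle : t * (2 * (`|a| + `|b|)) = `|a|.
  by rewrite /t divfK // lt0r_neq0 // mulr_gt0.
have b0 := normr_ge0 b.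
have na : `|a| = - a by rewrite ltr0_norm.
have t1 : t <= 1.
  by rewrite /t ler_pdivrMr ?mulr_gt0 // mul1r; have := normr_ge0 a; lra.
have := H t; rewrite t0 t1 => /(_ isT).
have -> : t * a + t ^+ 2 * b = t * (a + t * b) by ring.
rewrite pmulr_rge0 //.
have : t * b <= t * `|b| by rewrite ler_pM2l // ler_norm.
rewrite na in tle; nra.
Qed.

Lemma simplex_convex n (p q : 'cV[K]_n) t : 0 <= t <= 1 ->
  simplex n p -> simplex n q -> simplex n (p + t *: (q - p)).
Proof.
move=> /andP[t0 t1] [p0 p1] [q0 q1]; split=> [i|].
  rewrite !mxE; have := p0 i; have := q0 i; nra.
under eq_bigr do rewrite !mxE.
by rewrite big_split /= p1 -mulr_sumr big_split /= sumrN p1 q1 subrr mulr0 addr0.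
Qed.

Lemma simplex_l1 n (p : 'cV[K]_n) : simplex n p -> \sum_i `|p i 0| = 1.
Proof. by move=> [p0 <-]; apply: eq_bigr => i _; rewrite ger0_norm. Qed.

Lemma simplex_delta n (i : 'I_n) : simplex n (delta_mx i 0 : 'cV[K]_n).
Proof.
split=> [j|]; first by rewrite mxE; case: (_ && _).
rewrite (bigD1 i) //= mxE !eqxx big1 ?addr0// => j /negbTE ji.
by rewrite mxE ji.
Qed.

Lemma simplex_sqdist_le n (p q : 'cV[K]_n) :
  simplex n p -> simplex n q -> dotp (p - q) (p - q) <= 2.
Proof.
move=> [p0 p1] [q0 q1]; rewrite dotpE.
apply: (@le_trans _ _ (\sum_i (p i 0 + q i 0))); last first.
  by rewrite big_split /= p1 q1.
have le1 (r : 'cV[K]_n) : (forall i, 0 <= r i 0) -> \sum_i r i 0 = 1 ->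
    forall i, r i 0 <= 1.
  move=> r0 <- i; rewrite (bigD1 i) //= lerDl; exact: sumr_ge0.
apply: ler_sum => i _; rewrite !mxE.
have := p0 i; have := q0 i; have := le1 _ p0 p1 i; have := le1 _ q0 q1 i; nra.
Qed.


(** A closed slice of the unit cube. Row vectors appear because [rV_compact] and [EVT_min_rV] are
    stated for them. *)
Lemma simplex_rV_compact n :
  compact [set r : 'rV[K]_n | (forall i, 0 <= r 0 i) /\ \sum_i r 0 i = 1].
Proof.
have cube : compact [set r : 'rV[K]_n | forall i, `[0, 1]%classic (r ord0 i)].
  exact: (@rV_compact K n (fun=> `[0, 1]%classic) (fun=> @segment_compact K 0 1)).
have csum : continuous (fun r : 'rV[K]_n => \sum_i r 0 i).
  apply: continuous_big => [|i _]; first exact: add_continuous.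
  exact: coord_continuous.
rewrite (_ : mkset _ = [set r : 'rV[K]_n | forall i, `[0, 1]%classic (r ord0 i)]
   `&` (fun r : 'rV[K]_n => \sum_i r 0 i) @^-1` [set 1]).
  apply: compact_closedI => //.
  apply: closed_comp; last exact: closed_eq.
  by move=> r _; exact: csum.
apply/seteqP; split=> r /= [].
  move=> r0 r1; split=> // i; rewrite in_itv /= r0 /= -r1 (bigD1 i) //= lerDl.
  exact: sumr_ge0.
by move=> rc r1; split=> // i; have := rc i; rewrite in_itv /= => /andP[].
Qed.

(** This shape of objective serves twice: the identity matrix with squared distances gives
    projections, and [A^T] with squared positive parts gives Ville's alternative. *)
Lemma simplex_argmin_ex n m (x0 : 'cV[K]_n) (phi : 'I_m -> K -> K)
    (a : 'M[K]_(m, n)) : simplex n x0 -> (forall j, continuous (phi j)) ->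
  exists2 p, simplex n p & forall q, simplex n q ->
    \sum_j phi j ((a *m p) j 0) <= \sum_j phi j ((a *m q) j 0).
Proof.
move=> [x00 x01] cphi.
pose f (r : 'rV[K]_n) := \sum_j phi j ((a *m r^T) j 0).
have cf : continuous f.
  apply: continuous_big => [|j _]; first exact: add_continuous.
  move=> r; apply: (@continuous_comp _ _ _ (fun r : 'rV[K]_n => (a *m r^T) j 0)
    (phi j)); last exact: cphi.
  rewrite (_ : (fun _ => _) = fun r : 'rV[K]_n => \sum_i a j i * r 0 i); last first.
    by apply/funext => s; rewrite mxE; apply: eq_bigr => i _; rewrite mxE.
  move: r; apply: continuous_big => [|i _]; first exact: add_continuous.
  move=> r; apply: continuousM; first exact: cst_continuous.
  exact: coord_continuous.
have ne : [set r : 'rV[K]_n | (forall i, 0 <= r 0 i) /\ \sum_i r 0 i = 1] !=set0.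
  exists x0^T; split=> [i|]; first by rewrite mxE.
  by rewrite -x01; apply: eq_bigr => i _; rewrite mxE.
have [c cS cmin] := EVT_min_rV ne (@simplex_rV_compact n) (continuous_subspaceT cf).
move: cS; rewrite inE => -[c0 c1].
exists c^T => [|q [q0 q1]].
  split=> [i|]; first by rewrite mxE.
  by rewrite -c1; apply: eq_bigr => i _; rewrite mxE.
have := cmin q^T; rewrite inE /f trmxK; apply; split=> [i|]; first by rewrite mxE.
by rewrite -q1; apply: eq_bigr => i _; rewrite mxE.
Qed.

Lemma is_proj_ex n (x0 z : 'cV[K]_n) : simplex n x0 ->
  exists p, is_proj (simplex n) z p.
Proof.
move=> x0S; pose phi (j : 'I_n) (s : K) : K := (z j 0 - s) ^+ 2.
have cphi j : continuous (phi j).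
  move=> s; rewrite /phi.
  apply: (@continuous_comp _ _ _ (fun s => z j 0 - s) (fun s => s ^+ 2)).
    by apply: continuousB; [exact: cst_continuous|exact: cvg_id].
  exact: exprn_continuous.
have [p pS pmin] := simplex_argmin_ex 1%:M x0S cphi.
have phiE q : \sum_j phi j ((1%:M *m q) j 0) = dotp (z - q) (z - q).
  by rewrite mul1mx dotpE; apply: eq_bigr => j _; rewrite /phi !mxE expr2.
exists p; split=> // q qS; rewrite /l2norm ler_wsqrtr // -!phiE.
exact: pmin.
Qed.

(** Moving from [p] towards [q] by [t] changes the squared distance to [z] by a quadratic in [t] of
    slope [-2 <z - p, q - p>], which must be nonnegative. *)
Lemma proj_variational n (z p q : 'cV[K]_n) : is_proj (simplex n) z p ->
  simplex n q -> dotp (z - p) (q - p) <= 0.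
Proof.
move=> [pS pmin] qS.
suff : 0 <= - (2 * dotp (z - p) (q - p)) by lra.
apply: (quadratic_ge0_slope (b := dotp (q - p) (q - p))) => t /andP[t0 t1].
have /pmin : simplex n (p + t *: (q - p)).
  by apply: simplex_convex => //; rewrite ltW.
rewrite /l2norm ler_sqrt ?dotp_ge0 //.
rewrite (_ : z - (p + t *: (q - p)) = (z - p) - t *: (q - p)); last first.
  by rewrite opprD addrA.
move: (z - p) (q - p) => u v.
rewrite !dotp_bilin (dotpC v u); nra.
Qed.

End Simplex.

(** * The minimax theorem for ratio games *)

Section Bilin.
Variable K : realType.

Lemma bilinEr m n (M : 'M[K]_(m, n)) (x : 'cV[K]_m) (y : 'cV[K]_n) :
  bilin M x y = dotp x (M *m y).
Proof. by rewrite /bilin /dotp mulmxA. Qed.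

Lemma bilin_tr m n (M : 'M[K]_(m, n)) (x : 'cV[K]_m) (y : 'cV[K]_n) :
  bilin M x y = bilin M^T y x.
Proof.
by rewrite bilinEr dotpC /dotp /bilin trmx_mul.
Qed.

Lemma bilinEl m n (M : 'M[K]_(m, n)) (x : 'cV[K]_m) (y : 'cV[K]_n) :
  bilin M x y = dotp (M^T *m x) y.
Proof. by rewrite bilin_tr bilinEr dotpC. Qed.

Lemma dotp_delta n (i : 'I_n) (u : 'cV[K]_n) : dotp (delta_mx i 0) u = u i 0.
Proof.
rewrite dotpE (bigD1 i) //= mxE !eqxx mul1r big1 ?addr0// => j /negbTE ji.
by rewrite mxE ji mul0r.
Qed.

Lemma bilin_delta m n (M : 'M[K]_(m, n)) i (y : 'cV[K]_n) :
  bilin M (delta_mx i 0) y = (M *m y) i 0.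
Proof. by rewrite bilinEr dotp_delta. Qed.

Lemma dotp_norm_le n (u w : 'cV[K]_n) B :
  (forall i, `|w i 0| <= B) -> `|dotp u w| <= B * \sum_i `|u i 0|.
Proof.
move=> wB; rewrite dotpE mulr_sumr (le_trans (ler_norm_sum _ _ _)) //.
by apply: ler_sum => i _; rewrite normrM mulrC ler_wpM2r.
Qed.

Lemma mulmx_norm_le m n (M : 'M[K]_(m, n)) (y : 'cV[K]_n) B :
  (forall i j, `|M i j| <= B) -> forall i, `|(M *m y) i 0| <= B * \sum_j `|y j 0|.
Proof.
move=> MB i; rewrite mxE mulr_sumr (le_trans (ler_norm_sum _ _ _)) //.
by apply: ler_sum => j _; rewrite normrM ler_wpM2r.
Qed.

Lemma mulmx_simplex_norm_le m n (M : 'M[K]_(m, n)) (y : 'cV[K]_n) B :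
  (forall i j, `|M i j| <= B) -> simplex n y -> forall i, `|(M *m y) i 0| <= B.
Proof.
by move=> MB yS i; have := mulmx_norm_le y MB i; rewrite simplex_l1 // mulr1.
Qed.

Lemma bilin_simplex_norm_le m n (M : 'M[K]_(m, n)) (x : 'cV[K]_m) (y : 'cV[K]_n) B :
  (forall i j, `|M i j| <= B) -> simplex m x -> simplex n y -> `|bilin M x y| <= B.
Proof.
move=> MB xS yS; rewrite bilinEr.
have := dotp_norm_le x (mulmx_simplex_norm_le MB yS).
by rewrite simplex_l1 // mulr1.
Qed.

Lemma dotp_simplex_ge n (x w : 'cV[K]_n) c :
  simplex n x -> (forall i, c <= w i 0) -> c <= dotp x w.
Proof.
move=> [x0 x1] cw; rewrite dotpE -[c]mul1r -x1 mulr_suml.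
by apply: ler_sum => i _; rewrite ler_wpM2l.
Qed.

Lemma dotp_simplex_le n (x w : 'cV[K]_n) c :
  simplex n x -> (forall i, w i 0 <= c) -> dotp x w <= c.
Proof.
move=> xS cw; rewrite -lerN2 -dotpNr; apply: dotp_simplex_ge => // i.
by rewrite mxE lerN2.
Qed.

(** The squared positive part has the 2-Lipschitz derivative [2 max(0, z)], whence this quadratic
    upper bound. *)
Lemma sqr_posp_le (z d : K) :
  Num.max 0 (z + d) ^+ 2 <= Num.max 0 z ^+ 2 + 2 * d * Num.max 0 z + d ^+ 2.
Proof.
by case: (lerP 0 z) => ?; case: (lerP 0 (z + d)) => ?; nra.
Qed.

(* Minimise sum_j ((x^T A)_j^+)^2 over the simplex.  At a minimiser with
   nonzero value, the vector of positive parts, normalised, is the y sought: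
   this is exactly the first-order condition in the directions e_i - x. *)
Lemma ville_alternative m n (A : 'M[K]_(m, n)) (x0 : 'cV[K]_m) : simplex m x0 ->
  (exists2 x, simplex m x & forall j, (A^T *m x) j 0 <= 0) \/
  (exists2 y, simplex n y & forall i, 0 < (A *m y) i 0).
Proof.
move=> x0S; pose phi (j : 'I_n) (s : K) : K := Num.max 0 s ^+ 2.
have cphi j : continuous (phi j).
  move=> s; apply: (@continuous_comp _ _ _ (fun s : K => Num.max 0 s) (fun s => s ^+ 2)).
    apply: (@continuous_max K K (fun=> 0) id); first exact: cst_continuous.
    exact: cvg_id.
  exact: exprn_continuous.
have [p pS pmin] := simplex_argmin_ex A^T x0S cphi.
pose w : 'cV[K]_n := \col_j Num.max 0 ((A^T *m p) j 0).
have w0 j : 0 <= w j 0 by rewrite mxE le_max lexx.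
pose s := \sum_j w j 0.
have s0 : 0 <= s by exact: sumr_ge0.
have first_order q : simplex m q -> 0 <= dotp w (A^T *m (q - p)).
  move=> qS; suff : 0 <= 2 * dotp w (A^T *m (q - p)) by rewrite pmulr_rge0.
  pose d := A^T *m (q - p).
  apply: (quadratic_ge0_slope (b := dotp d d)) => t /andP[t0 t1].
  have /pmin : simplex m (p + t *: (q - p)) by apply: simplex_convex => //; rewrite ltW.
  rewrite -subr_ge0 => /le_trans; apply.
  rewrite -/d !dotpE mulr_sumr !mulr_sumr -big_split /= -sumrB.
  apply: ler_sum => j _; rewrite /phi mulmxDr -scalemxAr -/d.
  have -> : (A^T *m p + t *: d) j 0 = (A^T *m p) j 0 + t * d j 0 by rewrite !mxE.
  have := sqr_posp_le ((A^T *m p) j 0) (t * d j 0).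
  have -> : w j 0 = Num.max 0 ((A^T *m p) j 0) by rewrite mxE.
  lra.
have wAp : dotp w (A^T *m p) = dotp w w.
  rewrite !dotpE; apply: eq_bigr => j _.
  have -> : w j 0 = Num.max 0 ((A^T *m p) j 0) by rewrite mxE.
  by case: lerP; rewrite ?mul0r.
have [sz|snz] := eqVneq s 0.
  left; exists p => // j.
  have : w j 0 <= s by rewrite /s (bigD1 j) //= lerDl sumr_ge0.
  by rewrite sz mxE ge_max => /andP[].
right; have spos : 0 < s by rewrite lt_neqAle eq_sym snz.
have wpos : 0 < dotp w w.
  rewrite lt_neqAle dotp_ge0 andbT eq_sym; apply: contra_neq snz => /eqP.
  rewrite dotpE psumr_eq0 => [/allP z|j _]; last by rewrite mulr_ge0.
  rewrite /s big1 // => j _; have := z j (mem_index_enum _).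
  by rewrite mulf_eq0 orbb => /eqP.
exists (s^-1 *: w).
  split=> [i|]; first by rewrite mxE mulr_ge0 ?invr_ge0.
  under eq_bigr do rewrite mxE.
  by rewrite -mulr_sumr mulVf.
move=> i; rewrite -scalemxAr mxE pmulr_rgt0 ?invr_gt0 //.
have := first_order _ (simplex_delta K i).
rewrite mulmxBr dotpDr dotpNr wAp subr_ge0 => /(lt_le_trans wpos).
by rewrite dotpC -bilinEl bilin_delta.
Qed.

Lemma mx_coord_norm_le m n (M : 'M[K]_(m, n)) i j : `|M i j| <= `|M|.
Proof.
rewrite /Num.Def.normr /= mx_normrE.
exact: (@le_bigmax_cond _ _ _ _ (i, j) predT (fun k => `|M k.1 k.2|)).
Qed.

Lemma positive_margin n (f : 'I_n -> K) :
  (forall i, 0 < f i) -> exists2 c, 0 < c & forall i, c <= f i.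
Proof.
move=> f0; exists (\big[Num.min/1]_i f i); first by apply: lt_bigmin.
by move=> i; exact: bigmin_le.
Qed.

Section Saddle.
Variables (m n : nat) (R S : 'M[K]_(m, n)) (zeta : K).
Hypothesis zeta0 : 0 < zeta.
Hypothesis Sge : forall x y, simplex m x -> simplex n y -> zeta <= bilin S x y.

(* The infimum v of {v | exists x, x^T (R - v S) <= 0} is attained, and has a
   certificate ys, since otherwise Ville's alternative gives a strict solution
   for the other player, which survives a small change of v. *)
Lemma ratio_minimax (x0 : 'cV[K]_m) (y0 : 'cV[K]_n) : simplex m x0 -> simplex n y0 ->
  exists xs ys v, [/\ simplex m xs, simplex n ys,
    (forall j, ((R - v *: S)^T *m xs) j 0 <= 0) &
    (forall i, 0 <= ((R - v *: S) *m ys) i 0)].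
Proof.
move=> x0S y0S.
have bilinB v x y : bilin (R - v *: S) x y = bilin R x y - v * bilin S x y.
  by rewrite !bilinEr mulmxBl -scalemxAl !dotp_bilin.
have [B B0 [RB SB]] : exists2 B : K, 0 < B &
    (forall i j, `|R i j| <= B) /\ (forall i j, `|S i j| <= B).
  exists (`|R| + `|S| + 1) => [|]; first by rewrite ltr_wpDl ?addr_ge0.
  split=> i j.
    apply: (le_trans (@mx_coord_norm_le _ _ R i j)).
    by rewrite -addrA lerDl addr_ge0.
  apply: (le_trans (@mx_coord_norm_le _ _ S i j)).
  by rewrite addrAC lerDr addr_ge0.
pose P := [set v : K | exists2 x, simplex m x &
  forall j, ((R - v *: S)^T *m x) j 0 <= 0].
have Pbilin v x y : simplex n y -> (forall j, ((R - v *: S)^T *m x) j 0 <= 0) ->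
    bilin R x y <= v * bilin S x y.
  move=> yS xP; rewrite -subr_le0 -bilinB bilinEl dotpC.
  exact: dotp_simplex_le.
have hasP : has_inf P.
  split.
    (* At this value [x0] has nonpositive payoff against every [y], since [x0^T R y <= B] and
       [(B / zeta) x0^T S y >= B]; the second alternative is thus impossible. *)
    exists (B / zeta).
    have [[x xS xP]|[y yS yP]] := ville_alternative (R - (B / zeta) *: S) x0S.
      by exists x.
    have [c c0 cy] := positive_margin yP.
    have := dotp_simplex_ge x0S cy; rewrite -bilinEr bilinB.
    have := ler_norm (bilin R x0 y); have := bilin_simplex_norm_le RB x0S yS.
    have : B <= B / zeta * bilin S x0 y.
      by rewrite mulrAC ler_pdivlMr // ler_pM2l // Sge.
    lra.
  exists (- (B / zeta)) => v [x xS xP].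
  have := Pbilin _ _ _ y0S xP.
  have := Sge xS y0S; set b := bilin S _ _ => zb.
  have := bilin_simplex_norm_le RB xS y0S; rewrite ler_norml => /andP[+ _].
  move=> H1 H2; rewrite leNgt; apply/negP => vB.
  have : v * b < - (B / zeta) * b by rewrite ltr_pM2r // (lt_le_trans zeta0).
  have : B <= B / zeta * b by rewrite mulrAC ler_pdivlMr // ler_pM2l.
  lra.
pose v := inf P.
have [xs [xsS xsP]] : exists xs, simplex m xs /\
    forall j, ((R - v *: S)^T *m xs) j 0 <= 0.
  have [[x xS xP]|[y yS yP]] := ville_alternative (R - v *: S) x0S; first by exists x.
  have [c c0 cy] := positive_margin yP.
  (* Raising [v] by [c / B] lowers the payoff by at most [c], because [x^T S y <= B]; the margin [c]
     therefore excludes every [v'] below [v + c / B]. *)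
  have [v' [x xS xP] v'lt] := inf_adherent (divr_gt0 c0 B0) hasP.
  have := dotp_simplex_ge xS cy; rewrite -bilinEr bilinB.
  have := Pbilin _ _ _ yS xP.
  have := bilin_simplex_norm_le SB xS yS; rewrite ler_norml => /andP[_].
  have := Sge xS yS; set b := bilin S _ _ => zb bB H1 H2.
  have b0 : 0 < b by exact: lt_le_trans zb.
  have : v' * b < (v + c / B) * b by rewrite ltr_pM2r.
  have : c / B * b <= c by rewrite mulrAC ler_pdivrMr // ler_pM2l.
  lra.
exists xs; have [[ys ysS ysP]|[x xS xP]] := ville_alternative (- (R - v *: S)^T) y0S.
  exists ys, v; split=> // i.
  by have := ysP i; rewrite linearN /= trmxK mulNmx mxE oppr_le0.
have [c c0 cx] := positive_margin xP.
suff /(ge_inf hasP.2) : P (v - c / B).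
  by rewrite -/v; have := divr_gt0 c0 B0; lra.
exists x => // j.
have coordE w : ((R - w *: S)^T *m x) j 0 =
    bilin R x (delta_mx j 0) - w * bilin S x (delta_mx j 0).
  by rewrite -bilinB bilinEl dotpC dotp_delta.
have := cx j; rewrite mulNmx mxE !coordE.
have := bilin_simplex_norm_le SB xS (simplex_delta K j).
rewrite ler_norml => /andP[_]; set b := bilin S _ _ => sB.
have : c / B * b <= c by rewrite mulrAC ler_pdivrMr // ler_pM2l.
lra.
Qed.

(** The value [v] separates the two sides: dividing the linear certificates by the positive
    denominators gives [V(xs, y) <= v <= V(x, ys)]. *)
Lemma ratioV_saddle (x0 : 'cV[K]_m) (y0 : 'cV[K]_n) : simplex m x0 -> simplex n y0 ->
  exists xs ys, [/\ simplex m xs, simplex n ys &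
    forall x y, simplex m x -> simplex n y -> ratioV R S xs y <= ratioV R S x ys].
Proof.
move=> x0S y0S; have [xs [ys [v [xsS ysS xsP ysP]]]] := ratio_minimax x0S y0S.
have bilinB x y : bilin (R - v *: S) x y = bilin R x y - v * bilin S x y.
  by rewrite !bilinEr mulmxBl -scalemxAl !dotp_bilin.
exists xs, ys; split=> // x y xS yS; apply: (@le_trans _ _ v).
  rewrite /ratioV ler_pdivrMr ?(lt_le_trans zeta0) ?Sge // -subr_le0 -bilinB.
  by rewrite bilinEl dotpC; exact: dotp_simplex_le.
rewrite /ratioV ler_pdivlMr ?(lt_le_trans zeta0) ?Sge // -subr_ge0 -bilinB.
by rewrite bilinEr; exact: dotp_simplex_ge.
Qed.

End Saddle.
End Bilin.

(** * Optimistic descent *)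

Section OptimisticDescent.
Variable K : realType.

(** The projection defining [x1] is tested at [xh1], the one defining [xh1] at [u]. The cross term
    [2 eta <g1 - g0, x1 - xh1>] is split by Young's inequality, which consumes half of
    [|x1 - xh1|^2]. *)
Lemma ogd_step n (eta : K) (xh g0 g1 x1 xh1 u : 'cV[K]_n) :
  is_proj (simplex n) (xh - eta *: g0) x1 ->
  is_proj (simplex n) (xh - eta *: g1) xh1 -> simplex n u ->
  2 * eta * dotp g1 (x1 - u) + dotp (xh1 - u) (xh1 - u) +
    dotp (x1 - xh) (x1 - xh) + 2^-1 * dotp (x1 - xh1) (x1 - xh1) <=
  dotp (xh - u) (xh - u) + 2 * eta ^+ 2 * dotp (g1 - g0) (g1 - g0).
Proof.
move=> px pxh uS.
have := proj_variational px pxh.1; have := proj_variational pxh uS.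
have := dotp_ge0 ((2 * eta) *: (g1 - g0) - (x1 - xh1)).
rewrite !dotp_bilin (dotpC g1 g0) (dotpC u xh1) (dotpC x1 xh1) ?(dotpC x1 u)
 ?(dotpC x1 xh) ?(dotpC xh1 xh) ?(dotpC u xh) ?(dotpC x1 g0) ?(dotpC x1 g1)
 ?(dotpC xh1 g0) ?(dotpC xh1 g1) ?(dotpC u g0) ?(dotpC u g1).
lra.
Qed.

(** The vector [x1 - q] is split at [xh1]. The first part is short; for the second, optimality of
    [xh1] gives [eta <g, xh1 - q> <= <xh - xh1, xh1 - q>]. *)
Lemma ogd_gap n (eta d G : K) (xh g x1 xh1 q : 'cV[K]_n) :
  0 < eta -> 0 < d -> 0 < G ->
  is_proj (simplex n) (xh - eta *: g) xh1 -> simplex n q ->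
  dotp (x1 - xh) (x1 - xh) + dotp (x1 - xh1) (x1 - xh1) <= d ^+ 2 ->
  dotp g g <= G ^+ 2 -> dotp g (x1 - q) <= (3 / eta + G) * d.
Proof.
move=> eta0 d0 G0 pxh qS dle gG.
have V := proj_variational pxh qS.
(* The squared lengths are at most [2 d^2] and [2], and [3 / 2] is a rational bound for the square
   root of 2. The product [9 / 4] is later rounded up to 3. *)
have H1 : dotp (xh - xh1) (xh1 - q) <= 3 / 2 * d * (3 / 2).
  apply: dotp_le; [lra|lra| |].
    have := dotp_ge0 ((x1 - xh) + (x1 - xh1)); move: dle.
    rewrite !dotp_bilin (dotpC xh x1) (dotpC xh1 x1) (dotpC xh1 xh); nra.
  have := simplex_sqdist_le pxh.1 qS; lra.
have H2 : dotp g (x1 - xh1) <= G * d.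
  by apply: dotp_le => //; have := dotp_ge0 (x1 - xh); lra.
have H3 : dotp g (xh1 - q) <= 3 / eta * d.
  rewrite mulrAC ler_pdivlMr // mulrC.
  move: V H1; rewrite !dotp_bilin (dotpC xh1 q); nra.
have -> : x1 - q = (x1 - xh1) + (xh1 - q) by rewrite addrA subrK.
rewrite dotpDr; lra.
Qed.

(** Telescoping bounds the sum of the first [m] terms by [Psi 0], so they cannot all exceed the
    average. *)
Lemma ex_small_term (m : nat) (Psi c : nat -> K) : (0 < m)%N ->
  (forall i, Psi i.+1 + c i <= Psi i) -> 0 <= Psi m ->
  exists2 i, (i < m)%N & m%:R * c i <= Psi 0%N.
Proof.
move=> m0 H Pm; apply/not_exists2P => small.
have big i : (i < m)%N -> Psi 0%N / m%:R < c i.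
  move=> im; rewrite ltr_pdivrMr ?ltr0n // mulrC ltNge; apply/negP => ?.
  by have [] := small i.
have : \sum_(i < m) c i <= Psi 0%N - Psi m.
  rewrite -opprB -(telescope_sumr _ (leq0n m)) big_mkord -sumrN.
  by apply: ler_sum => i _; have := H i; lra.
have : \sum_(i < m) Psi 0%N / m%:R < \sum_(i < m) c i.
  case: m m0 {H Pm small} big => // m _ big.
  rewrite !big_ord_recl ltr_leD ?big //.
  by apply: ler_sum => i _; rewrite ltW // big.
rewrite sumr_const card_ord -[(_ / _) *+ m]mulr_natr divfK ?pnatr_eq0 -?lt0n //; lra.
Qed.

Section Convergence.
Variables (dx dy : nat) (eta L : K).
(** Both players descend here: [gx] and [gy] include the weights, and [gy] stands for the negated
    gradient of the maximising player. *)
Variables (x xh gx : nat -> 'cV[K]_dx) (y yh gy : nat -> 'cV[K]_dy).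
Variables (xs : 'cV[K]_dx) (ys : 'cV[K]_dy).
Hypotheses (eta0 : 0 < eta) (L0 : 0 <= L) (etaL : 16 * (eta ^+ 2 * L) <= 1).
Hypotheses (xsS : simplex dx xs) (ysS : simplex dy ys).
Hypotheses (x0 : x 0%N = xh 0%N) (y0 : y 0%N = yh 0%N).
Hypotheses (x0S : simplex dx (x 0%N)) (y0S : simplex dy (y 0%N)).
Hypothesis projx : forall i, is_proj (simplex dx) (xh i - eta *: gx i) (x i.+1).
Hypothesis projxh :
  forall i, is_proj (simplex dx) (xh i - eta *: gx i.+1) (xh i.+1).
Hypothesis projy : forall i, is_proj (simplex dy) (yh i - eta *: gy i) (y i.+1).
Hypothesis projyh :
  forall i, is_proj (simplex dy) (yh i - eta *: gy i.+1) (yh i.+1).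
Hypothesis lip : forall i,
  dotp (gx i.+1 - gx i) (gx i.+1 - gx i) + dotp (gy i.+1 - gy i) (gy i.+1 - gy i)
  <= L * (dotp (x i.+1 - x i) (x i.+1 - x i) + dotp (y i.+1 - y i) (y i.+1 - y i)).
Hypothesis regret : forall i,
  0 <= dotp (gx i.+1) (x i.+1 - xs) + dotp (gy i.+1) (y i.+1 - ys).

Let a i := dotp (x i.+1 - xh i) (x i.+1 - xh i) + dotp (y i.+1 - yh i) (y i.+1 - yh i).
Let b i := dotp (x i - xh i) (x i - xh i) + dotp (y i - yh i) (y i - yh i).

(* The squared distance of the hatted iterates to (xs, ys), plus b i / 4,
   decreases by at least (a i + b i.+1) / 4 at every step. *)
Lemma ogd_small_step m : (0 < m)%N ->
  exists2 i, (i < m)%N & m%:R * (a i + b i.+1) <= 16.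
Proof.
move=> m0.
pose Phi i := dotp (xh i - xs) (xh i - xs) + dotp (yh i - ys) (yh i - ys).
have b_ge0 i : 0 <= b i by rewrite addr_ge0 ?dotp_ge0.
have a_ge0 i : 0 <= a i by rewrite addr_ge0 ?dotp_ge0.
pose Psi i := Phi i + 4^-1 * b i.
have descent i : Psi i.+1 + 4^-1 * (a i + b i.+1) <= Psi i.
  have sx := ogd_step (projx i) (projxh i) xsS.
  have sy := ogd_step (projy i) (projyh i) ysS.
  have split_sq n (u v w : 'cV[K]_n) :
      dotp (u - v) (u - v) <= 2 * (dotp (u - w) (u - w) + dotp (v - w) (v - w)).
    have := dotp_ge0 ((u - w) + (v - w)).
    rewrite !dotp_bilin (dotpC v u) (dotpC w u) (dotpC w v); lra.
  have := split_sq _ (x i.+1) (x i) (xh i).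
  have := split_sq _ (y i.+1) (y i) (yh i).
  have := regret i; have := lip i; rewrite /Psi /Phi.
  have := b_ge0 i; have := a_ge0 i; have := b_ge0 i.+1.
  move: sx sy; rewrite /a /b.
  move: (dotp (gx i.+1 - gx i) _) (dotp (gy i.+1 - gy i) _) => Gx Gy.
  move: (dotp (x i.+1 - x i) _) (dotp (y i.+1 - y i) _) => Dx Dy.
  move=> sx sy b1 a0 b0 lipi reg Dyle Dxle.
  have regeta : 0 <= 2 * eta * (dotp (gx i.+1) (x i.+1 - xs) +
      dotp (gy i.+1) (y i.+1 - ys)) by rewrite !mulr_ge0 // ltW.
  (* Splitting each move from step [i] to [i.+1] at the hatted iterate costs a factor 2, and
     [16 eta^2 L <= 1] turns the resulting [4 eta^2 L] into at most [1 / 4]. *)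
  have G_le : 2 * eta ^+ 2 * (Gx + Gy) <=
      4^-1 * (dotp (x i.+1 - xh i) (x i.+1 - xh i) +
        dotp (y i.+1 - yh i) (y i.+1 - yh i) +
        (dotp (x i - xh i) (x i - xh i) + dotp (y i - yh i) (y i - yh i))).
    move: a0 b0 Dxle Dyle; move: (dotp (x i.+1 - xh i) _) (dotp (y i.+1 - yh i) _)
     (dotp (x i - xh i) _) (dotp (y i - yh i) _) => ax ay bx by_ a0 b0 Dxle Dyle.
    have D_le : Dx + Dy <= 2 * (ax + ay + (bx + by_)) by lra.
    apply: (@le_trans _ _ (2 * eta ^+ 2 * (L * (Dx + Dy)))).
      by rewrite ler_wpM2l // mulr_ge0 // sqr_ge0.
    have T0 : 0 <= ax + ay + (bx + by_) by lra.
    have : eta ^+ 2 * L * (Dx + Dy) <= eta ^+ 2 * L * (2 * (ax + ay + (bx + by_))).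
      by rewrite ler_wpM2l // mulr_ge0 // sqr_ge0.
    have : eta ^+ 2 * L * (ax + ay + (bx + by_)) <= 16^-1 * (ax + ay + (bx + by_)).
      by rewrite ler_wpM2r // -[16^-1]mul1r ler_pdivlMr // mulrC.
    lra.
  lra.
(* Initially [b 0 = 0], and each simplex has squared diameter at most 2. Undoing the factor [1 / 4]
   of the descent gives 16. *)
have Psi0 : Psi 0%N <= 4.
  have dotp00 n : dotp 0 (0 : 'cV[K]_n) = 0 by rewrite /dotp mulmx0 mxE.
  rewrite /Psi /Phi /b -x0 -y0 !subrr !dotp00.
  have := simplex_sqdist_le x0S xsS; have := simplex_sqdist_le y0S ysS; lra.
have Psim : 0 <= Psi m by rewrite !addr_ge0 ?mulr_ge0 ?dotp_ge0.
have [i im le] := ex_small_term m0 descent Psim.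
by exists i => //; lra.
Qed.

End Convergence.
End OptimisticDescent.

(** * Weighted gradients of the ratio game *)

Section Gradient.
Variables (K : realType) (m n : nat).

Lemma bilinDZl (M : 'M[K]_(m, n)) h u v y :
  bilin M (h *: v + u) y = h * bilin M v y + bilin M u y.
Proof. by rewrite !bilinEr dotpDl dotpZl. Qed.

(** By linearity the difference quotient is constant away from [h = 0]. *)
Lemma is_derive_bilinl (M : 'M[K]_(m, n)) x v y :
  is_derive x v (fun u => bilin M u y) (bilin M v y).
Proof.
have c : h^-1 *: (((fun u => bilin M u y) \o shift x) (h *: v) - bilin M x y)
    @[h --> (0 : K)^'] --> bilin M v y.
  apply: cvg_near_cst; near=> h.
  rewrite /= bilinDZl addrK /GRing.scale /= mulKf //.
  by near: h; exact: nbhs_dnbhs_neq.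
by apply: DeriveDef; [apply/cvg_ex; exists (bilin M v y)|exact: cvg_lim c].
Unshelve. all: by end_near. Qed.

(** The gradient in [x] multiplied by the weight of that player: the factor [x^T S y] cancels and
    leaves [xs^T S y] as denominator. *)
Definition wgradx (R S : 'M[K]_(m, n)) xs x y : 'cV[K]_m :=
  (bilin S xs y)^-1 *: (R *m y - ratioV R S x y *: (S *m y)).

Lemma gradxE (R S : 'M[K]_(m, n)) x y : bilin S x y != 0 ->
  gradx (ratioV R S) x y =
  (bilin S x y)^-1 *: (R *m y - ratioV R S x y *: (S *m y)).
Proof.
move=> S0; apply/colP => j; rewrite mxE.
pose v : 'cV[K]_m := delta_mx j 0.
have [dR vR] := is_derive_bilinl R x v y.
have [dS vS] := is_derive_bilinl S x v y.
pose fS (u : 'cV[K]_m) : K := bilin S u y.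
have dVinv := @derivableV _ _ fS _ _ S0 dS.
have vVinv := @deriveV _ _ fS _ _ S0 dS.
have E := deriveM dR dVinv.
rewrite vVinv vR vS in E.
apply: (etrans E).
rewrite /v !bilin_delta /GRing.scale /= !mxE /ratioV /fS.
by field.
Qed.

Lemma weightx_gradx (R S : 'M[K]_(m, n)) xs x y i :
  bilin S (x i) (y i) != 0 ->
  weightx S xs x y i *: gradx (ratioV R S) (x i) (y i) = wgradx R S xs (x i) (y i).
Proof.
by move=> S0; rewrite gradxE // scalerA /weightx /wgradx mulrAC divff // mul1r.
Qed.

(** This identity is the purpose of the weights: for [q = xs] the factor is 1 and the linearised
    regret is the exact difference of values, although [V] need not be convex in [x]. For other [q]
    on the simplex the factor is positive. *)
Lemma dotp_wgradx (R S : 'M[K]_(m, n)) xs x y q :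
  bilin S x y != 0 -> bilin S q y != 0 ->
  dotp (wgradx R S xs x y) (x - q) =
  bilin S q y / bilin S xs y * (ratioV R S x y - ratioV R S q y).
Proof.
move=> Sx Sq; rewrite /wgradx !dotp_bilin !(dotpC (_ *m _)) -!bilinEr.
have EV u : bilin S u y != 0 -> bilin R u y = ratioV R S u y * bilin S u y.
  by move=> Su; rewrite /ratioV divfK.
rewrite (EV _ Sx) (EV _ Sq).
ring.
Qed.

End Gradient.

Lemma ratioV_tr (K : realType) m n (R S : 'M[K]_(m, n)) x y :
  ratioV R S x y = ratioV R^T S^T y x.
Proof. by rewrite /ratioV !(bilin_tr _ x). Qed.

Lemma grady_tr (K : realType) m n (R S : 'M[K]_(m, n)) x y :
  grady (ratioV R S) x y = gradx (ratioV R^T S^T) y x.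
Proof.
by rewrite /grady /gradx; congr gradient; apply/funext => v; rewrite ratioV_tr.
Qed.

Lemma weighty_tr (K : realType) m n (S : 'M[K]_(m, n)) ys x y i :
  weighty S ys x y i = weightx S^T ys y x i.
Proof. by rewrite /weighty /weightx !(bilin_tr S). Qed.

(** * Calculus of bounded Lipschitz functions *)

Section Close.
Variables (K : realType) (N : K).
Hypothesis N0 : 0 <= N.

(* The data of a bounded Lipschitz function at two points at distance N. *)
Definition close (B a a' : K) := [/\ `|a| <= B, `|a'| <= B & `|a - a'| <= B * N].

Lemma close_ge0 B a a' : close B a a' -> 0 <= B.
Proof. by case=> + _ _; apply: le_trans. Qed.

Lemma close_le B B' a a' : B <= B' -> close B a a' -> close B' a a'.
Proof.
move=> BB' [aB aB' d]; split; [lra|lra|].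
by rewrite (le_trans d) // ler_wpM2r.
Qed.

Lemma close_sub B B' a a' b b' :
  close B a a' -> close B' b b' -> close (B + B') (a - b) (a' - b').
Proof.
move=> [aB aB' ad] [bB bB' bd]; split.
- by rewrite (le_trans (ler_normB _ _)) // lerD.
- by rewrite (le_trans (ler_normB _ _)) // lerD.
have -> : a - b - (a' - b') = a - a' - (b - b') by ring.
by rewrite (le_trans (ler_normB _ _)) // mulrDl lerD.
Qed.

Lemma close_mul B B' a a' b b' :
  close B a a' -> close B' b b' -> close (2 * B * B') (a * b) (a' * b').
Proof.
move=> aa' bb'; have B0 := close_ge0 aa'; have B0' := close_ge0 bb'.
move: aa' bb' => [aB aB' ad] [bB bB' bd].
have BB0 : 0 <= B * B' by exact: mulr_ge0.
split.
- rewrite normrM (@le_trans _ _ (B * B')) //; [exact: ler_pM|lra].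
- rewrite normrM (@le_trans _ _ (B * B')) //; [exact: ler_pM|lra].
have -> : a * b - a' * b' = a * (b - b') + (a - a') * b' by ring.
rewrite (le_trans (ler_normD _ _)) // !normrM.
have -> : 2 * B * B' * N = B * (B' * N) + (B * N) * B' by ring.
by rewrite lerD // ler_pM.
Qed.

(** The difference of inverses is the difference of [b] and [b'] times two inverses, each at most
    [P]. *)
Lemma close_inv P zeta b b' : 0 < zeta -> zeta^-1 <= P -> 1 <= P ->
  zeta <= b -> zeta <= b' -> close P b b' -> close (P ^+ 3) b^-1 b'^-1.
Proof.
move=> z0 zP P1 zb zb' [_ _ d].
have b0 : 0 < b by exact: lt_le_trans zb.
have b0' : 0 < b' by exact: lt_le_trans zb'.
have P3 : P <= P ^+ 3 by rewrite -[leLHS]expr1 ler_weXn2l.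
have inv_le c : zeta <= c -> `|c^-1| <= P.
  move=> zc; have c0 : 0 < c by exact: lt_le_trans zc.
  rewrite ger0_norm; last by rewrite invr_ge0 ltW.
  by apply: le_trans zP; rewrite lef_pV2.
split; [by rewrite (le_trans (inv_le _ zb))|by rewrite (le_trans (inv_le _ zb'))|].
have -> : b^-1 - b'^-1 = - ((b - b') * (b^-1 * b'^-1)).
  by field; rewrite !lt0r_neq0.
rewrite normrN !normrM.
have -> : P ^+ 3 * N = P * N * (P * P) by ring.
by rewrite ler_pM ?mulr_ge0 // ler_pM // inv_le.
Qed.

End Close.

(** * Bounds for the weighted gradients and for the gap of one player *)

Section Lipschitz.
Variables (K : realType) (m n : nat) (R S : 'M[K]_(m, n)) (zeta P : K).
(** One number [P] dominates all parameters, so that constants become numerical multiples of powers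
    of [P]. *)
Hypotheses (zeta0 : 0 < zeta) (zetaP : zeta^-1 <= P) (P1 : 1 <= P).
Hypotheses (RP : forall i j, `|R i j| <= P) (SP : forall i j, `|S i j| <= P).
Hypothesis Sge : forall x y, simplex m x -> simplex n y -> zeta <= bilin S x y.

Lemma mulmx_close (M : 'M[K]_(m, n)) (y y' : 'cV[K]_n) N i :
  (forall i j, `|M i j| <= P) -> simplex n y -> simplex n y' ->
  \sum_j `|(y - y') j 0| <= N -> close N P ((M *m y) i 0) ((M *m y') i 0).
Proof.
move=> MP yS yS' dN; split; [exact: mulmx_simplex_norm_le..|].
have -> : (M *m y) i 0 - (M *m y') i 0 = (M *m (y - y')) i 0.
  by rewrite mulmxBr !mxE.
rewrite (le_trans (mulmx_norm_le (y - y') MP i)) // ler_wpM2l //.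
by rewrite (le_trans ler01).
Qed.

Lemma bilin_close (M : 'M[K]_(m, n)) (x x' : 'cV[K]_m) (y y' : 'cV[K]_n) N :
  (forall i j, `|M i j| <= P) ->
  simplex m x -> simplex m x' -> simplex n y -> simplex n y' ->
  \sum_j `|(x - x') j 0| + \sum_j `|(y - y') j 0| <= N ->
  close N P (bilin M x y) (bilin M x' y').
Proof.
move=> MP xS xS' yS yS' dN; split; [exact: bilin_simplex_norm_le..|].
have P0 : 0 <= P by rewrite (le_trans ler01).
have -> : bilin M x y - bilin M x' y' =
    dotp (x - x') (M *m y) + dotp x' (M *m (y - y')).
  by rewrite !bilinEr mulmxBr !dotp_bilin; ring.
rewrite (le_trans (ler_normD _ _)) //.
apply: (@le_trans _ _ (P * (\sum_j `|(x - x') j 0| + \sum_j `|(y - y') j 0|))).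
  rewrite mulrDr lerD //.
    exact: dotp_norm_le (mulmx_simplex_norm_le MP yS).
  have := dotp_norm_le x' (mulmx_norm_le (y - y') MP).
  by rewrite (simplex_l1 xS') mulr1.
by rewrite ler_wpM2l.
Qed.

Lemma wgradx_close (xs x x' : 'cV[K]_m) (y y' : 'cV[K]_n) i :
  simplex m xs -> simplex m x -> simplex m x' -> simplex n y -> simplex n y' ->
  close (\sum_j `|(x - x') j 0| + \sum_j `|(y - y') j 0|) (10 * P ^+ 8)
    (wgradx R S xs x y i 0) (wgradx R S xs x' y' i 0).
Proof.
move=> xsS xS xS' yS yS'; set N := _ + _.
have Nx0 : 0 <= \sum_j `|(x - x') j 0| by exact: sumr_ge0.
have Ny0 : 0 <= \sum_j `|(y - y') j 0| by exact: sumr_ge0.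
have N0 : 0 <= N by exact: addr_ge0.
have dyN : \sum_j `|(y - y') j 0| <= N by rewrite lerDr.
have cR := mulmx_close i RP yS yS' dyN.
have cS := mulmx_close i SP yS yS' dyN.
have cbR := bilin_close RP xS xS' yS yS' (lexx N).
have cbS := bilin_close SP xS xS' yS yS' (lexx N).
have cxs : close N P (bilin S xs y) (bilin S xs y').
  apply: bilin_close => //.
  by rewrite subrr big1 ?add0r // => j _; rewrite mxE normr0.
(* The constants accumulate as follows: [2 P^4] for [V], [4 P^5] for [V] times [S y], at most
   [5 P^5] after adding [R y], and [10 P^8] after multiplying by the inverse of [xs^T S y]. *)
have cV := close_mul cbR (close_inv zeta0 zetaP P1 (Sge xS yS) (Sge xS' yS') cbS).
have cG := close_mul (close_inv zeta0 zetaP P1 (Sge xsS yS) (Sge xsS yS') cxs)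
  (close_sub cR (close_mul cV cS)).
have coordE u v : wgradx R S xs u v i 0 =
    (bilin S xs v)^-1 * ((R *m v) i 0 -
      bilin R u v / bilin S u v * (S *m v) i 0) by rewrite !mxE.
rewrite !coordE; apply: (close_le N0 _ cG).
have P0 : 0 <= P by rewrite (le_trans ler01).
have P5 : P <= P ^+ 5 by rewrite -[leLHS]expr1 ler_weXn2l.
have -> : 10 * P ^+ 8 = 2 * P ^+ 3 * (P ^+ 5 + 4 * P ^+ 5) by ring.
rewrite ler_wpM2l ?mulr_ge0 ?exprn_ge0 //.
have -> : 2 * (2 * P * P ^+ 3) * P = 4 * P ^+ 5 by ring.
by rewrite lerD2r.
Qed.

Lemma dotp_le_coord k (u : 'cV[K]_k) c :
  (forall i, `|u i 0| <= c) -> dotp u u <= k%:R * c ^+ 2.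
Proof.
move=> uc; rewrite dotpE mulr_natl.
rewrite -[X in _ *+ X]card_ord -sumr_const; apply: ler_sum => i _.
by rewrite -expr2 -real_normK ?num_real // lerXn2r // nnegrE (le_trans _ (uc i)).
Qed.

Lemma wgradx_sqnorm_le (xs x : 'cV[K]_m) (y : 'cV[K]_n) :
  m%:R <= P -> simplex m xs -> simplex m x -> simplex n y ->
  dotp (wgradx R S xs x y) (wgradx R S xs x y) <= (10 * P ^+ 9) ^+ 2.
Proof.
move=> mP xsS xS yS.
have P0 : 0 <= P by rewrite (le_trans ler01).
have /dotp_le_coord /le_trans -> // : forall i, `|wgradx R S xs x y i 0| <= 10 * P ^+ 8.
  by move=> i; have [] := wgradx_close i xsS xS xS yS yS.
have -> : (10 * P ^+ 9) ^+ 2 = P ^+ 2 * (10 * P ^+ 8) ^+ 2 by ring.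
rewrite ler_wpM2r ?sqr_ge0 // (le_trans mP) //.
by rewrite -[leLHS]expr1 ler_weXn2l.
Qed.

(** The coordinatewise bound in the l1 distance is converted to Euclidean norms. The factor [m] is
    kept apart so that the constants of the two players add up through [dx + dy <= P]. *)
Lemma wgradx_lip (xs x x' : 'cV[K]_m) (y y' : 'cV[K]_n) :
  m%:R + n%:R <= P ->
  simplex m xs -> simplex m x -> simplex m x' -> simplex n y -> simplex n y' ->
  dotp (wgradx R S xs x y - wgradx R S xs x' y')
       (wgradx R S xs x y - wgradx R S xs x' y') <= m%:R * (200 * P ^+ 17) *
    (dotp (x - x') (x - x') + dotp (y - y') (y - y')).
Proof.
move=> mnP xsS xS xS' yS yS'.
have P0 : 0 <= P by rewrite (le_trans ler01).
set d := _ - _.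
pose N := \sum_j `|(x - x') j 0| + \sum_j `|(y - y') j 0|.
apply: (@le_trans _ _ (m%:R * (10 * P ^+ 8 * N) ^+ 2)).
  apply: dotp_le_coord => i.
  by have [_ _] := wgradx_close i xsS xS xS' yS yS'; rewrite /d !mxE.
rewrite -[leRHS]mulrA ler_wpM2l //.
have lx := l1_norm_sqr_le (x - x'); have ly := l1_norm_sqr_le (y - y').
have dx0 := dotp_ge0 (x - x'); have dy0 := dotp_ge0 (y - y').
have N2 : N ^+ 2 <= 2 * P * (dotp (x - x') (x - x') + dotp (y - y') (y - y')).
  apply: (@le_trans _ _ (2 * ((\sum_j `|(x - x') j 0|) ^+ 2 +
      (\sum_j `|(y - y') j 0|) ^+ 2))).
    rewrite /N; set s := \sum_j _; set t := \sum_j _.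
    by have := sqr_ge0 (s - t); nra.
  rewrite -[leRHS]mulrA ler_wpM2l // mulrDr lerD //.
    by rewrite (le_trans lx) // ler_wpM2r // (le_trans _ mnP) // lerDl.
  by rewrite (le_trans ly) // ler_wpM2r // (le_trans _ mnP) // lerDr.
have -> : (10 * P ^+ 8 * N) ^+ 2 = 100 * P ^+ 16 * N ^+ 2 by ring.
apply: (le_trans (ler_wpM2l _ N2)); first by rewrite mulr_ge0 ?exprn_ge0.
by rewrite le_eqVlt; apply/orP; left; apply/eqP; ring.
Qed.

(** The best vertex is a minimiser: after clearing the positive denominator, the comparison with its
    value is linear in [x] and need only be checked at vertices. *)
Lemma ratioV_min (y : 'cV[K]_n) (x0 : 'cV[K]_m) : simplex m x0 -> simplex n y ->
  exists2 q, simplex m q & forall x, simplex m x -> ratioV R S q y <= ratioV R S x y.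
Proof.
move=> x0S yS; case: m R S Sge x0 x0S => [|k] R' S' Sge' x0 x0S.
  by case: x0S => _ /eqP; rewrite big_ord0 eq_sym oner_eq0.
pose V i := ratioV R' S' (delta_mx i 0) y.
have [i _ imin] := @Order.TotalTheory.arg_minP _ _ _ ord0 predT V isT.
exists (delta_mx i 0) => [|x xS]; first exact: simplex_delta.
rewrite {2}/ratioV ler_pdivlMr ?(lt_le_trans zeta0) ?Sge' //.
rewrite -subr_ge0 !bilinEr -dotpZr -dotpNr -dotpDr.
apply: dotp_simplex_ge => // j.
have Sj := Sge' _ _ (simplex_delta K j) yS.
have := imin j isT; rewrite /V {2}/ratioV ler_pdivlMr ?(lt_le_trans zeta0) //.
by rewrite !bilin_delta !mxE subr_ge0.
Qed.

(** By [dotp_wgradx], the true gap is the linearised one times [xs^T S y / q^T S y], a factor at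
    most [P^2]. *)
Lemma ratioV_gap (xs x q : 'cV[K]_m) (y : 'cV[K]_n) c : 0 <= c ->
  simplex m xs -> simplex m x -> simplex m q -> simplex n y ->
  dotp (wgradx R S xs x y) (x - q) <= c ->
  ratioV R S x y - ratioV R S q y <= P ^+ 2 * c.
Proof.
move=> c0 xsS xS qS yS.
have Sx := Sge xS yS; have Sq := Sge qS yS; have Ss := Sge xsS yS.
have pos b : zeta <= b -> 0 < b by apply: lt_le_trans.
rewrite dotp_wgradx ?lt0r_neq0 ?pos //.
have P0 : 0 <= P by rewrite (le_trans ler01).
have bsP : bilin S xs y <= P.
  exact: le_trans (ler_norm _) (bilin_simplex_norm_le SP xsS yS).
have bqP : (bilin S q y)^-1 <= P.
  by apply: le_trans zetaP; rewrite lef_pV2 ?posrE ?pos.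
move: (ratioV R S x y - _) Sq Ss bsP bqP => D.
move: (bilin S q y) (bilin S xs y) => bq bs /pos bq0 /pos bs0 bsP bqP Dc.
have -> : D = bs * bq^-1 * (bq / bs * D) by field; rewrite !lt0r_neq0.
have w0 : 0 <= bs * bq^-1 by rewrite mulr_ge0 ?invr_ge0 // ltW.
apply: (le_trans (ler_wpM2l w0 Dc)); rewrite ler_wpM2r // expr2.
by rewrite ler_pM ?invr_ge0 // ltW.
Qed.

End Lipschitz.

(** * Convergence *)

(** The weights are functions of the current point alone, so the iterates can be built by recursion.
    Each step computes [x'] and [y'] first, since the hatted iterates use the weights at the new
    point. *)
Lemma ogd_exists (K : realType) (dx dy : nat) (V : 'cV[K]_dx -> 'cV[K]_dy -> K)
    (eta : K) (wx wy : 'cV[K]_dx -> 'cV[K]_dy -> K) x0 y0 :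
  simplex dx x0 -> simplex dy y0 ->
  exists x xh y yh, is_OGD (simplex dx) (simplex dy) V eta
    (fun i => wx (x i) (y i)) (fun i => wy (x i) (y i)) x0 y0 x xh y yh.
Proof.
move=> x0S y0S.
have [px pxP] := choice (fun z => is_proj_ex z x0S).
have [py pyP] := choice (fun z => is_proj_ex z y0S).
pose step (s : ('cV[K]_dx * 'cV[K]_dx) * ('cV[K]_dy * 'cV[K]_dy)) :=
  let gx u v := (eta * wx u v) *: gradx V u v in
  let gy u v := (eta * wy u v) *: grady V u v in
  let x' := px (s.1.2 - gx s.1.1 s.2.1) in
  let y' := py (s.2.2 + gy s.1.1 s.2.1) in
  ((x', px (s.1.2 - gx x' y')), (y', py (s.2.2 + gy x' y'))).
pose s i := iter i step ((x0, x0), (y0, y0)).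
exists (fun i => (s i).1.1), (fun i => (s i).1.2), (fun i => (s i).2.1),
  (fun i => (s i).2.2).
by split=> // i; split.
Qed.

Lemma ratioVN (K : realType) m n (R S : 'M[K]_(m, n)) x y :
  ratioV (- R) S x y = - ratioV R S x y.
Proof. by rewrite /ratioV !bilinEr mulNmx dotpNr mulNr. Qed.

Lemma wgradxN (K : realType) m n (R S : 'M[K]_(m, n)) xs x y :
  wgradx (- R) S xs x y = - wgradx R S xs x y.
Proof.
rewrite /wgradx -[RHS]scalerN ratioVN mulNmx; congr (_ *: _).
by rewrite scaleNr opprB opprK addrC.
Qed.

Section RatioGameOGD.
Variables (K : realType) (dx dy : nat) (R S : 'M[K]_(dx, dy)) (zeta P : K).
Hypotheses (zeta0 : 0 < zeta) (zetaP : zeta^-1 <= P) (P1 : 1 <= P).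
Hypotheses (RP : forall i j, `|R i j| <= P) (SP : forall i j, `|S i j| <= P).
Hypothesis dP : dx%:R + dy%:R <= P.
Hypothesis Sge : forall x y, simplex dx x -> simplex dy y -> zeta <= bilin S x y.

Let V := ratioV R S.
(** With the joint Lipschitz constant [L = 200 P^18], this gives [16 eta^2 L = 8 / 9]. *)
Let eta := (60 * P ^+ 9)^-1.

(* The maximising player y minimises the ratio game of the matrices - R^T and
   S^T, so every statement about the player x applies to y as well. *)
Let RT := - R^T.
Let ST := S^T.

Variables (x0 xs : 'cV[K]_dx) (y0 ys : 'cV[K]_dy).
Variables (x xh : nat -> 'cV[K]_dx) (y yh : nat -> 'cV[K]_dy).
Hypotheses (x0S : simplex dx x0) (y0S : simplex dy y0).
Hypotheses (xsS : simplex dx xs) (ysS : simplex dy ys).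
Hypothesis saddle : forall u v, simplex dx u -> simplex dy v -> V xs v <= V u ys.
Hypothesis ogd : is_OGD (simplex dx) (simplex dy) V eta
  (weightx S xs x y) (weighty S ys x y) x0 y0 x xh y yh.

Let STge u v : simplex dy u -> simplex dx v -> zeta <= bilin ST u v.
Proof. by move=> uS vS; rewrite /ST -bilin_tr Sge. Qed.

Let RTP i j : `|RT i j| <= P. Proof. by rewrite !mxE normrN. Qed.
Let STP i j : `|ST i j| <= P. Proof. by rewrite mxE. Qed.

Let S_neq0 u v : simplex dx u -> simplex dy v -> bilin S u v != 0.
Proof. by move=> uS vS; rewrite lt0r_neq0 // (lt_le_trans zeta0) ?Sge. Qed.

Let VT u v : ratioV RT ST v u = - V u v.
Proof. by rewrite ratioVN /V (ratioV_tr R). Qed.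

Lemma ogd_simplex i : simplex dx (x i) /\ simplex dy (y i).
Proof.
case: ogd => -[xx0 _] [yy0 _] H; case: i => [|i]; first by rewrite xx0 yy0.
by have [[? _] _ [? _] _] := H i.
Qed.

Let gx i := wgradx R S xs (x i) (y i).
Let gy i := wgradx RT ST ys (y i) (x i).

Let gxE i : weightx S xs x y i *: gradx V (x i) (y i) = gx i.
Proof. by have [xS yS] := ogd_simplex i; rewrite weightx_gradx ?S_neq0. Qed.

Let gyE i : weighty S ys x y i *: grady V (x i) (y i) = - gy i.
Proof.
have [xS yS] := ogd_simplex i.
rewrite weighty_tr grady_tr weightx_gradx; last by rewrite -bilin_tr S_neq0.
by rewrite /gy wgradxN opprK.
Qed.

Let regretx i : dotp (gx i) (x i - xs) = V (x i) (y i) - V xs (y i).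
Proof.
have [xS yS] := ogd_simplex i.
by rewrite dotp_wgradx ?S_neq0 // divff ?S_neq0 // mul1r.
Qed.

Let regrety i : dotp (gy i) (y i - ys) = V (x i) ys - V (x i) (y i).
Proof.
have [xS yS] := ogd_simplex i.
rewrite dotp_wgradx -?bilin_tr ?S_neq0 // divff; last exact: S_neq0.
by rewrite mul1r !VT opprK addrC.
Qed.

Lemma ogd_regret_ge0 m : regret_sum_ge0 V (weightx S xs x y) (weighty S ys x y)
  x y xs ys m.
Proof.
rewrite /regret_sum_ge0 -big_split /= sumr_ge0 // => i _.
rewrite -!dotpZl gxE gyE regretx dotpNl -dotpNr opprB regrety addrC subrKA subr_ge0.
by have [xS yS] := ogd_simplex i; exact: saddle.
Qed.

Let P0 : 0 < P. Proof. exact: lt_le_trans ltr01 P1. Qed.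
Let eta0 : 0 < eta. Proof. by rewrite invr_gt0 mulr_gt0 ?exprn_gt0. Qed.

Let gap i d q r : 0 < d -> simplex dx q -> simplex dy r ->
  dotp (x i.+1 - xh i) (x i.+1 - xh i) + dotp (y i.+1 - yh i) (y i.+1 - yh i) +
  (dotp (x i.+1 - xh i.+1) (x i.+1 - xh i.+1) +
   dotp (y i.+1 - yh i.+1) (y i.+1 - yh i.+1)) <= d ^+ 2 ->
  V (x i.+1) (y i.+1) - V q (y i.+1) <= 190 * P ^+ 11 * d /\
  V (x i.+1) r - V (x i.+1) (y i.+1) <= 190 * P ^+ 11 * d.
Proof.
move=> d0 qS rS dle; have [xS yS] := ogd_simplex i.+1.
case: ogd => _ _ /(_ i) [_ px _ py].
have G0 : 0 < 10 * P ^+ 9 by rewrite mulr_gt0 ?exprn_gt0.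
have c0 : 0 <= (3 / eta + 10 * P ^+ 9) * d.
  by rewrite mulr_ge0 ?addr_ge0 ?divr_ge0 // ltW.
(* Here [3 / eta = 180 P^9], and [P^2] is the factor from [ratioV_gap]. *)
have cE : 190 * P ^+ 11 * d = P ^+ 2 * ((3 / eta + 10 * P ^+ 9) * d).
  by rewrite /eta invrK; ring.
have dxP : dx%:R <= P by rewrite (le_trans _ dP) // lerDl.
have dyP : dy%:R <= P by rewrite (le_trans _ dP) // lerDr.
have sq0 := (dotp_ge0 (x i.+1 - xh i), dotp_ge0 (y i.+1 - yh i),
  dotp_ge0 (x i.+1 - xh i.+1), dotp_ge0 (y i.+1 - yh i.+1)).
rewrite cE; split.
  apply: (ratioV_gap zeta0 zetaP P1 SP Sge c0 xsS) => //.
  apply: (ogd_gap eta0 d0 G0 (xh := xh i) (xh1 := xh i.+1)) => //.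
  - by rewrite -[wgradx _ _ _ _ _]gxE scalerA.
  - by case: sq0 => -[[? ?] ?] ?; lra.
  exact: (wgradx_sqnorm_le zeta0 zetaP P1 RP SP Sge).
have -> : V (x i.+1) r - V (x i.+1) (y i.+1) =
    ratioV RT ST (y i.+1) (x i.+1) - ratioV RT ST r (x i.+1).
  by rewrite !VT opprK addrC.
apply: (ratioV_gap zeta0 zetaP P1 STP STge c0 ysS) => //.
apply: (ogd_gap eta0 d0 G0 (xh := yh i) (xh1 := yh i.+1)) => //.
- by rewrite -scalerN -gyE scalerA.
- by case: sq0 => -[[? ?] ?] ?; lra.
exact: (wgradx_sqnorm_le zeta0 zetaP P1 RTP STP STge).
Qed.

Lemma ogd_eps_equilibrium eps m : 0 < eps ->
  760 ^+ 2 * P ^+ 22 / eps ^+ 2 <= m%:R ->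
  exists2 i, (1 <= i <= m)%N &
    eps_equilibrium (simplex dx) (simplex dy) V eps (x i) (y i).
Proof.
move=> e0 mle.
have m0 : (0 < m)%N.
  have c0 : 0 < 760 ^+ 2 :> K by apply: exprn_gt0; rewrite ltr0n.
  have : 0 < m%:R :> K.
    apply: lt_le_trans mle; apply: divr_gt0; last exact: exprn_gt0.
    by apply: mulr_gt0 c0 _; exact: exprn_gt0.
  by rewrite ltr0n.
have [[xx0 xhx0] [yy0 yhy0] step] := ogd.
pose L := 200 * P ^+ 18.
have L0 : 0 <= L by rewrite mulr_ge0 // exprn_ge0 // ltW.
have etaL : 16 * (eta ^+ 2 * L) <= 1.
  have -> : 16 * (eta ^+ 2 * L) = 8 / 9.
    by rewrite /L /eta; field; rewrite lt0r_neq0.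
  by lra.
have projx i : is_proj (simplex dx) (xh i - eta *: gx i) (x i.+1).
  by have [p _ _ _] := step i; rewrite -gxE scalerA.
have projxh i : is_proj (simplex dx) (xh i - eta *: gx i.+1) (xh i.+1).
  by have [_ p _ _] := step i; rewrite -gxE scalerA.
have projy i : is_proj (simplex dy) (yh i - eta *: gy i) (y i.+1).
  by have [_ _ p _] := step i; rewrite -scalerN -gyE scalerA.
have projyh i : is_proj (simplex dy) (yh i - eta *: gy i.+1) (yh i.+1).
  by have [_ _ _ p] := step i; rewrite -scalerN -gyE scalerA.
have lip i : dotp (gx i.+1 - gx i) (gx i.+1 - gx i) +
    dotp (gy i.+1 - gy i) (gy i.+1 - gy i) <=
    L * (dotp (x i.+1 - x i) (x i.+1 - x i) + dotp (y i.+1 - y i) (y i.+1 - y i)).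
  have [xS yS] := ogd_simplex i; have [xS' yS'] := ogd_simplex i.+1.
  have := wgradx_lip zeta0 zetaP P1 RP SP Sge dP xsS xS' xS yS' yS.
  have dP' : dy%:R + dx%:R <= P by rewrite addrC.
  have := wgradx_lip zeta0 zetaP P1 RTP STP STge dP' ysS yS' yS xS' xS.
  rewrite -/(gx i) -/(gx i.+1) -/(gy i) -/(gy i.+1).
  have := dotp_ge0 (x i.+1 - x i); have := dotp_ge0 (y i.+1 - y i).
  move: (dotp (x i.+1 - x i) _) (dotp (y i.+1 - y i) _) => Dx Dy Dy0 Dx0.
  move=> Ly Lx; apply: (le_trans (lerD Lx Ly)).
  rewrite (addrC Dy) -!mulrDl ler_wpM2r ?addr_ge0 //.
  have -> : L = P * (200 * P ^+ 17) by rewrite /L; ring.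
  by rewrite ler_wpM2r // mulr_ge0 // exprn_ge0 // ltW.
have regret i : 0 <= dotp (gx i.+1) (x i.+1 - xs) + dotp (gy i.+1) (y i.+1 - ys).
  rewrite regretx regrety addrC subrKA subr_ge0.
  by have [xS yS] := ogd_simplex i.+1; exact: saddle.
have x0E : x 0%N = xh 0%N by rewrite xx0 xhx0.
have y0E : y 0%N = yh 0%N by rewrite yy0 yhy0.
have [x00 y00] := ogd_simplex 0%N.
have [i im small] := ogd_small_step eta0 L0 etaL xsS ysS x0E y0E x00 y00
  projx projxh projy projyh lip regret m0.
(* The movement at which the gap bound equals [eps]. The requirement [m >= 16 / d^2] reads
   [760^2 P^22 / eps^2], as [760 = 4 * 190]. *)
pose d := eps / (190 * P ^+ 11).
have q0 : 0 < 190 * P ^+ 11 by rewrite mulr_gt0 ?exprn_gt0.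
have d0 : 0 < d by rewrite divr_gt0.
have dE : 190 * P ^+ 11 * d = eps by rewrite /d mulrC divfK // lt0r_neq0.
have dle : dotp (x i.+1 - xh i) (x i.+1 - xh i) +
    dotp (y i.+1 - yh i) (y i.+1 - yh i) +
    (dotp (x i.+1 - xh i.+1) (x i.+1 - xh i.+1) +
     dotp (y i.+1 - yh i.+1) (y i.+1 - yh i.+1)) <= d ^+ 2.
  have mK : 0 < m%:R :> K by rewrite ltr0n.
  rewrite -(ler_pM2l mK) (le_trans small) //.
  have -> : 16 = 760 ^+ 2 * P ^+ 22 / eps ^+ 2 * d ^+ 2 :> K.
    by rewrite /d; field; rewrite !lt0r_neq0.
  by rewrite ler_wpM2r // sqr_ge0.
have [xS yS] := ogd_simplex i.+1.
have [qx qxS qxmin] := ratioV_min R zeta0 Sge xS yS.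
have [qy qyS qymin] := ratioV_min RT zeta0 STge yS xS.
have [gapx gapy] := gap d0 qxS qyS dle.
rewrite dE in gapx gapy.
exists i.+1; first by rewrite ltnS.
split=> //.
  exists (V qx (y i.+1)) => //; split; first by exists qx.
  by move=> _ [u uS <-]; exact: qxmin.
exists (V (x i.+1) qy) => //; split; first by exists qy.
by move=> _ [u uS <-]; rewrite -lerN2 -!VT; exact: qymin.
Qed.

End RatioGameOGD.

(* The factors suppressed by O(1/eps^2) are bounded by C * P ^ k, where
   P = 1 + dx + dy + 1/zeta + |R| + |S| (entrywise max norms) collects the
   parameters of the game and C, k are absolute constants. *)
Theorem theoremC31 (K : realType) :
  exists C k : nat,
  forall (dx dy : nat) (R S : 'M[K]_(dx, dy)) (zeta : K),
    0 < zeta ->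
    (forall (x : 'cV[K]_dx) (y : 'cV[K]_dy),
        simplex dx x -> simplex dy y -> zeta <= bilin S x y) ->
  exists2 eta : K, 0 < eta &
  forall (x0 : 'cV[K]_dx) (y0 : 'cV[K]_dy),
    simplex dx x0 -> simplex dy y0 ->
  forall (eps : K) (m : nat),
    0 < eps ->
    C%:R * (1 + dx%:R + dy%:R + zeta^-1 + `|R| + `|S|) ^+ k / eps ^+ 2 <= m%:R ->
  exists (xs : 'cV[K]_dx) (ys : 'cV[K]_dy)
         (x xh : nat -> 'cV[K]_dx) (y yh : nat -> 'cV[K]_dy),
    let V := ratioV R S in
    let ax := weightx S xs x y in
    let ay := weighty S ys x y in
    [/\ simplex dx xs /\ simplex dy ys,
        is_OGD (simplex dx) (simplex dy) V eta ax ay x0 y0 x xh y yh,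
        regret_sum_ge0 V ax ay x y xs ys m &
        exists2 i : nat, (1 <= i <= m)%N &
          eps_equilibrium (simplex dx) (simplex dy) V eps (x i) (y i)].
Proof.
exists (760 ^ 2)%N, 22%N => dx dy R S zeta zeta0 Sge.
set P := 1 + _ + _ + _ + _ + _.
have zi0 : 0 < zeta^-1 by rewrite invr_gt0.
have dx0 : 0 <= dx%:R :> K by []. have dy0 : 0 <= dy%:R :> K by [].
have R0 : 0 <= `|R| by []. have S0 : 0 <= `|S| by [].
have zetaP : zeta^-1 <= P by rewrite /P; lra.
have P1 : 1 <= P by rewrite /P; lra.
have dP : dx%:R + dy%:R <= P by rewrite /P; lra.
have RP i j : `|R i j| <= P.
  by apply: (le_trans (mx_coord_norm_le R i j)); rewrite /P; lra.
have SP i j : `|S i j| <= P.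
  by apply: (le_trans (mx_coord_norm_le S i j)); rewrite /P; lra.
(* The step size depends on the game only, not on [eps], [m] or the initial point. *)
exists (60 * P ^+ 9)^-1.
  by rewrite invr_gt0 mulr_gt0 // exprn_gt0 // (lt_le_trans ltr01).
move=> x0 y0 x0S y0S eps m eps0; rewrite natrX => mle.
(* Fixing the saddle point before the iterates avoids circularity: the weights become explicit
   functions of the current point. *)
have [xs [ys [xsS ysS saddle]]] := ratioV_saddle R zeta0 Sge x0S y0S.
have [x [xh [y [yh ogd]]]] := ogd_exists (ratioV R S) (60 * P ^+ 9)^-1
  (fun u v => bilin S u v / bilin S xs v) (fun u v => bilin S u v / bilin S u ys)
  x0S y0S.
exists xs, ys, x, xh, y, yh; split=> //.
  exact: (ogd_regret_ge0 zeta0 Sge x0S y0S xsS ysS saddle ogd).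
exact: (ogd_eps_equilibrium zeta0 zetaP P1 RP SP dP Sge x0S y0S xsS ysS saddle ogd).
Qed.
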